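(* Let $a,b,c,d,e,f$ be nonzero integers with $\gcd(a,b)=\gcd(c,d)=\gcd(e,f)=1$, such that none of the three pairs $(a,b)$, $(c,d)$, $(e,f)$ is of the form $(\pm1,\pm1)$ (for any choice of signs), and with $a<b$, $c<d$, $e<f$. Let $Q=Q(a,b;c,d;e,f)$. If $b-a$, $d-c$ and $f-e$ have no common divisor greater than $1$, then the commutator subgroup $Q'$ is abelian.
   Context: Conjugation convention: $x^y=y^{-1}xy$. For nonzero integers $a,\dots,f$, $$G(a,b;c,d;e,f)=\bigl\langle x,y,z \bigm| (x^a)^y=x^b,\ (y^c)^z=y^d,\ (z^e)^x=z^f\bigr\rangle .$$ Under the stated coprimality and non-$(\pm1,\pm1)$ hypotheses, $Q(a,b;c,d;e,f)$ denotes the universal quotient of $G(a,b;c,d;e,f)$ in which $x,y,z$ have finite order: $x,y,z$ have finite order in $Q$, and every quotient of $G$ in which $x,y,z$ have finite order factors through $Q$. (It exists and is a finite solvable group; it is obtained from $G$, when $a<b$, $c<d$, $e<f$, by adjoining the relations $x^{(b-a)^2(b^{d-c}-a^{d-c})}=1$, $y^{(d-c)^2(d^{f-e}-c^{f-e})}=1$, $z^{(f-e)^2(f^{b-a}-e^{b-a})}=1$.) *)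

(* Defs.v *)
From HB Require Import structures.
From mathcomp Require Import all_boot all_order all_algebra.
From mathcomp Require Import boolp.

Set Implicit Arguments.
Unset Strict Implicit.
Unset Printing Implicit Defensive.
Import Order.TTheory GRing.Theory Num.Theory.

(* The letter (s, false) stands for s and (s, true) for its inverse. *)
Definition word (S : Type) := seq (S * bool).

Definition wgen (S : Type) (s : S) : word S := [:: (s, false)].

Definition winv (S : Type) (w : word S) : word S :=
  rev [seq (l.1, ~~ l.2) | l <- w].

Definition wpow (S : Type) (w : word S) (k : int) : word S :=
  match k with
  | Posz n => flatten (nseq n w)
  | Negz n => flatten (nseq n.+1 (winv w))
  end.

Definition wconj (S : Type) (u v : word S) : word S := winv v ++ u ++ v.

(* The relation u = v is encoded by the relator u v^-1. *)
Definition wrel (S : Type) (u v : word S) : word S := u ++ winv v.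

Section Presentation.
Variables (S : choiceType) (R : seq (word S)).

(* Equality of words in the group <S | R>. *)
Inductive pres_eq : word S -> word S -> Prop :=
| PresRefl u : pres_eq u u
| PresSym u v : pres_eq u v -> pres_eq v u
| PresTrans u v w : pres_eq u v -> pres_eq v w -> pres_eq u w
| PresCancel u s b v : pres_eq (u ++ [:: (s, b); (s, ~~ b)] ++ v) (u ++ v)
| PresRelator u r v : r \in R -> pres_eq (u ++ r ++ v) (u ++ v).

(* Classical, as the word problem may be undecidable. *)
Definition pres_rel (u v : seq (S * bool)) : bool := `[< pres_eq u v >].

Lemma pres_rel_equiv : equiv_class_of pres_rel.
Proof.
split.
- by move=> u; apply/asboolP; apply: PresRefl.
- by move=> u v; apply/asboolP/asboolP; apply: PresSym.
- move=> v u w /asboolP uv /asboolP vw; apply/asboolP.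
  exact: PresTrans uv vw.
Qed.

Canonical pres_equiv := EquivRelPack pres_rel_equiv.

Definition presented := {eq_quot pres_rel}%qT.

HB.instance Definition _ := Choice.on presented.
HB.instance Definition _ := Quotient.on presented.

Definition pres_class (w : word S) : presented := (\pi_presented w)%qT.

Lemma pres_classP u v : pres_eq u v <-> pres_class u = pres_class v.
Proof.
split=> [uv|/eqP]; last by rewrite /pres_class eqmodE /= => /asboolP.
by apply/eqP; rewrite /pres_class eqmodE /=; apply/asboolP.
Qed.

Lemma pres_repr (g : presented) : pres_class (repr g) = g.
Proof. exact: reprK. Qed.

Lemma pres_eq_cat u u' v v' :
  pres_eq u u' -> pres_eq v v' -> pres_eq (u ++ v) (u' ++ v').
Proof.
move=> uu' vv'; apply: (@PresTrans _ (u' ++ v)).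
  elim: uu' => {u u'} [u|u u' _|u u' w _ + _|u s b u'|u r u' Rr].
  - exact: PresRefl.
  - exact: PresSym.
  - exact: PresTrans.
  - by rewrite -!catA; apply: PresCancel.
  - by rewrite -!catA; apply: PresRelator.
elim: vv' => {v v'} [v|v v' _|v v' w _ + _|v s b v'|v r v' Rr].
- exact: PresRefl.
- exact: PresSym.
- exact: PresTrans.
- by rewrite !(catA u'); apply: PresCancel.
- by rewrite !(catA u'); apply: PresRelator.
Qed.

Lemma winv_cat (u v : word S) : winv (u ++ v) = winv v ++ winv u.
Proof. by rewrite /winv map_cat rev_cat. Qed.

Lemma winvK : involutive (@winv S).
Proof.
move=> u; rewrite /winv map_rev revK -map_comp -[RHS]map_id.
by apply: eq_map => -[s b] /=; rewrite negbK.
Qed.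

Lemma pres_eq_mulVw u : pres_eq (winv u ++ u) [::].
Proof.
elim: u => [|[s b] u IHu]; first exact: PresRefl.
rewrite -cat1s winv_cat -catA (catA (winv [:: _])).
apply: PresTrans IHu; rewrite /winv /=.
have := @PresCancel (winv u) s (~~ b) u.
by rewrite negbK.
Qed.

Lemma pres_eq_winv u v : pres_eq u v -> pres_eq (winv u) (winv v).
Proof.
elim=> {u v} [u|u v _|u v w _ + _|u s b v|u r v Rr].
- exact: PresRefl.
- exact: PresSym.
- exact: PresTrans.
- rewrite !winv_cat -catA /winv /= negbK.
  have := @PresCancel (winv v) s b (winv u).
  by [].
- rewrite !winv_cat -catA.
  apply: pres_eq_cat; first exact: PresRefl.
  rewrite -[X in pres_eq _ X]cat0s.
  apply: pres_eq_cat; last exact: PresRefl.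
  apply: PresTrans (pres_eq_mulVw r).
  apply: PresSym; have := @PresRelator (winv r) r [::] Rr.
  by rewrite !cats0.
Qed.

Definition pres_mul (g h : presented) : presented :=
  pres_class (repr g ++ repr h).
Definition pres_inv (g : presented) : presented := pres_class (winv (repr g)).

Lemma pres_mulE u v :
  pres_mul (pres_class u) (pres_class v) = pres_class (u ++ v).
Proof.
by apply/pres_classP; apply: pres_eq_cat; apply/pres_classP; rewrite pres_repr.
Qed.

Lemma pres_invE u : pres_inv (pres_class u) = pres_class (winv u).
Proof.
by apply/pres_classP; apply: pres_eq_winv; apply/pres_classP; rewrite pres_repr.
Qed.

Lemma pres_mulA : associative pres_mul.
Proof.
move=> g h k; rewrite -(pres_repr g) -(pres_repr h) -(pres_repr k).
by rewrite !pres_mulE catA.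
Qed.

Lemma pres_mul1 : left_id (pres_class [::]) pres_mul.
Proof. by move=> g; rewrite -(pres_repr g) pres_mulE. Qed.

Lemma pres_mulr1 : right_id (pres_class [::]) pres_mul.
Proof. by move=> g; rewrite -(pres_repr g) pres_mulE cats0. Qed.

Lemma pres_mulV : left_inverse (pres_class [::]) pres_inv pres_mul.
Proof.
move=> g; rewrite -(pres_repr g) pres_invE pres_mulE.
by apply/pres_classP; apply: pres_eq_mulVw.
Qed.

Lemma pres_mulrV : right_inverse (pres_class [::]) pres_inv pres_mul.
Proof.
move=> g; rewrite -(pres_repr g) pres_invE pres_mulE.
apply/pres_classP; rewrite -{1}[repr g]winvK; exact: pres_eq_mulVw.
Qed.

HB.instance Definition _ :=
  isGroup.Build presented pres_mulA pres_mul1 pres_mulr1 pres_mulV pres_mulrV.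

Definition pres_gen (s : S) : presented := pres_class (wgen s).

End Presentation.

Local Open Scope group_scope.

(* The three generators x, y, z are the elements 0, 1, 2 of 'I_3. *)
Definition gx : 'I_3 := @Ordinal 3 0 isT.
Definition gy : 'I_3 := @Ordinal 3 1 isT.
Definition gz : 'I_3 := @Ordinal 3 2 isT.

Definition Grelators (a b c d e f : int) : seq (word 'I_3) :=
  let x := wgen gx in let y := wgen gy in let z := wgen gz in
  [:: wrel (wconj (wpow x a) y) (wpow x b);
      wrel (wconj (wpow y c) z) (wpow y d);
      wrel (wconj (wpow z e) x) (wpow z f)].

Definition Ggroup (a b c d e f : int) : groupType :=
  presented (Grelators a b c d e f).

Definition Ggen (a b c d e f : int) : 'I_3 -> Ggroup a b c d e f :=
  @pres_gen 'I_3 (Grelators a b c d e f).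

Definition finite_order (H : groupType) (h : H) : Prop :=
  exists n : nat, (0 < n)%N /\ h ^+ n = 1.

Definition surjective (A B : Type) (h : A -> B) : Prop :=
  forall y, exists x, h x = y.

(* H, with the projection phi, is a quotient of G(a,b;c,d;e,f) in which the
   images of x, y, z have finite order. *)
Definition finite_order_quotient (a b c d e f : int) (H : groupType)
    (phi : {multiplicative Ggroup a b c d e f -> H}) : Prop :=
  surjective phi /\ forall i, finite_order (phi (Ggen a b c d e f i)).

(* Q, with the projection pi, is Q(a,b;c,d;e,f); this determines (Q, pi) up to
   a unique isomorphism. *)
Definition is_Q (a b c d e f : int) (Q : groupType)
    (pi : {multiplicative Ggroup a b c d e f -> Q}) : Prop :=
  finite_order_quotient pi /\
  forall (H : groupType) (phi : {multiplicative Ggroup a b c d e f -> H}),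
    finite_order_quotient phi ->
    exists psi : {multiplicative Q -> H}, forall g, psi (pi g) = phi g.

(* Membership in the subgroup generated by all commutators; MathComp's
   commutator subgroups are restricted to finite groups. *)
Inductive derived (H : groupType) : H -> Prop :=
| DerivedComm u v : derived [~ u, v]
| DerivedOne : derived 1
| DerivedMul u v : derived u -> derived v -> derived (u * v)
| DerivedInv u : derived u -> derived u^-1.

Definition derived_abelian (H : groupType) : Prop :=
  forall u v : H, derived u -> derived v -> commute u v.

(* Main.v *)
Require Import Defs.
From mathcomp Require Import all_boot all_order all_algebra.
From mathcomp Require Import zify.
Import Order.TTheory GRing.Theory Num.Theory.
Set Implicit Arguments.
Unset Strict Implicit.
Unset Printing Implicit Defensive.
Local Open Scope group_scope.

(** In Q the element x has finite order n, and x^a, x^b are conjugate, hence of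
    the same order; as gcd(a, b) = 1 this forces a and b to be units modulo n.
    So y normalises <x>, say x^y = x^(r+1), where r is b-a times a unit modulo
    n; in the same way y^z = y^(s+1) and z^x = z^(t+1).  Then [x, y] = x^r,
    [y, z] = y^s, [z, x] = z^t, and the subgroup generated by these three
    elements is normal, so it is Q' ([conj_cycle_derived]).  It remains to see
    that the three elements commute.

    The Hall-Witt identity ([hall_witt]) reads A B C = 1, where
    A = x^((r+1)^(s+1) - (r+1)) and B, C are the analogous powers of y and z.
    The obstruction to x^r and y^s commuting is w = [A, y], a power of x; by
    A B C = 1 it is also [y, C], a power of y ([defect_expy]).  Three exponents
    kill w.
    - As a power of y, w commutes with y, which raises it to the power r+1; so
      w^r = 1, and hence w^(b-a) = 1.
    - [w, z] = w^s is a power of y, and also a power of z since z^x is a power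
      of z; so it commutes with z, whence w^(s^2) = 1,
      and hence w^((d-c)^2) = 1.
    - By the first item for the triple (z, x, y), C^(t^2) = 1, so C^(g^2)
      centralises y, for g = f-e.  Since w = [y, C] and C acts on <y> by an
      exponent congruent to 1 modulo s, w is killed by a number of the form
      g^2 + m s, hence, using w^(s^2) = 1, by g^4.
    Coprimality of b-a, d-c and f-e gives w = 1 ([defect_eq1]), and the cyclic
    symmetry of the relations gives the other two commutations. *)

(** * Powers and commutators *)

Lemma expg_gcdn_eq1 (H : groupType) (h : H) (m n : nat) :
  h ^+ m = 1 -> h ^+ n = 1 -> h ^+ gcdn m n = 1.
Proof.
have [-> //|m0] := posnP m; first by rewrite gcd0n.
move=> hm hn; have [km kn def_mn _] := egcdnP n m0.
by move: hm => /(congr1 (fun g => g ^+ km)); rewrite -expgnA mulnC def_mn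
  expgnDr mulnC expgnA hn !expg1n mul1g.
Qed.

Lemma conj_expg (H : groupType) (x y : H) (r m n : nat) :
  x ^ y = x ^+ r -> (x ^+ m) ^ (y ^+ n) = x ^+ (m * r ^ n).
Proof.
move=> xy; elim: n => [|n IHn]; first by rewrite conjg1 muln1.
by rewrite expgSr conjgM IHn conjXg xy -expgnA mulnCA expnS.
Qed.

Lemma commg_expg (H : groupType) (x y : H) (r m n : nat) :
  x ^ y = x ^+ r.+1 -> [~ x ^+ m, y ^+ n] = x ^+ (m * (r.+1 ^ n).-1).
Proof.
move=> xy; rewrite commgEl (conj_expg _ _ xy).
by rewrite -{1}(prednK (expn_gt0 r.+1 n)) mulnS expgnDr mulKg.
Qed.

Lemma commg_expg1 (H : groupType) (x y : H) (r m : nat) :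
  x ^ y = x ^+ r.+1 -> [~ x ^+ m, y] = x ^+ m ^+ r.
Proof.
by move=> xy; rewrite -[y in LHS]expg1 (commg_expg m 1 xy) expn1 expgnA.
Qed.

Lemma gcdn_expn (m n k : nat) : gcdn (m ^ k) (n ^ k) = (gcdn m n ^ k)%N.
Proof.
have [d0|d0] := posnP (gcdn m n).
  have [-> ->] : m = 0%N /\ n = 0%N.
    by have := dvdn_gcdl m n; have := dvdn_gcdr m n; rewrite d0 !dvd0n => /eqP-> /eqP->.
  by rewrite gcdnn.
have [/dvdnP[m' mE] /dvdnP[n' nE]] := (dvdn_gcdl m n, dvdn_gcdr m n).
have co : coprime m' n'.
  by rewrite /coprime -(eqn_pmul2r d0) muln_gcdl -mE -nE mul1n.
set d := gcdn m n in mE nE *; rewrite mE nE !expnMn -muln_gcdl.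
by rewrite (eqP (coprimeXl k (coprimeXr k co))) mul1n.
Qed.

(** In this form of the Hall-Witt identity the three factors are powers of x, y
    and z as soon as x^y, y^z and z^x are. *)
Lemma hall_witt (H : groupType) (x y z : H) :
  (x ^ y)^-1 * x ^ (y ^ z) * ((y ^ z)^-1 * y ^ (z ^ x))
    * ((z ^ x)^-1 * z ^ (x ^ y)) = 1.
Proof.
by rewrite !conjgE !invgM !invgK !mulgA !(mulgK, mulgVK, mulgV, mulVg).
Qed.

(** * Cycles of conjugation relations *)

Section ConjugationCycle.
Variable H : groupType.
Implicit Types (x y z : H) (r s t : nat).

Definition conj_cycle x y z r s t :=
  [/\ x ^ y = x ^+ r.+1, y ^ z = y ^+ s.+1 & z ^ x = z ^+ t.+1].

Lemma conj_cycle_rot x y z r s t :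
  conj_cycle x y z r s t -> conj_cycle y z x s t r.
Proof. by case. Qed.

(** The exponent of x in (x^y)^-1 x^(y^z), the first factor of the Hall-Witt
    identity. *)
Definition twist r s : nat := (r.+1 ^ s.+1 - r.+1)%N.

Lemma twistE r s : twist r s = ((r.+1 ^ s).-1 * r.+1)%N.
Proof. by rewrite /twist expnSr -subn1 mulnBl mul1n. Qed.

Lemma expg_twist x y z r s :
  x ^ y = x ^+ r.+1 -> y ^ z = y ^+ s.+1 ->
  (x ^ y)^-1 * x ^ (y ^ z) = x ^+ twist r s.
Proof.
move=> xy yz; have:= conj_expg 1 s.+1 xy; rewrite expg1 mul1n yz xy => ->.
rewrite -{1}(subnKC (_ : r.+1 <= r.+1 ^ s.+1)%N) ?expgnDr ?mulKg //.
by rewrite -{1}(expn1 r.+1) leq_pexp2l.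
Qed.

Lemma twist_prod x y z r s t : conj_cycle x y z r s t ->
  x ^+ twist r s * y ^+ twist s t * z ^+ twist t r = 1.
Proof.
case=> xy yz zx; rewrite -(hall_witt x y z).
by rewrite (expg_twist xy yz) (expg_twist yz zx) (expg_twist zx xy).
Qed.

(** [g^-1, y] = [h k, y] = [k, y] because h commutes with y, and [g^-1, y] is
    the inverse of [g, y] because g and g^y commute. *)
Lemma commg_transfer (g h k y : H) :
  g * h * k = 1 -> commute h y -> commute g (g ^ y) -> [~ g, y] = [~ y, k].
Proof.
move=> ghk hy gy.
have gV : g^-1 = h * k by apply: mulg1_eq; rewrite mulgA.
have hyK : h ^ y = h by apply/conjg_fixP/commgP.
apply: invg_inj; rewrite !invgR.
have -> : [~ y, g] = [~ g^-1, y].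
  rewrite -invgR !commgEl conjVg invgM invgK.
  exact/commute_sym/commuteV.
by rewrite gV !commgEl conjMg hyK invgM mulgA mulgVK.
Qed.

(** This is [A, y] for A = x^(twist r s), the obstruction to the commutation
    of x^r and y^s. *)
Definition defect x r s : H := x ^+ (twist r s * r).

Lemma defect_expy x y z r s t : conj_cycle x y z r s t ->
  defect x r s = y ^+ (s.+1 ^ twist t r).-1.
Proof.
move=> cyc; have [xy yz _] := cyc.
rewrite /defect expgnA -(commg_expg1 _ xy).
have := commg_expg 1 (twist t r) yz; rewrite expg1 mul1n /= => <-.
apply: commg_transfer (twist_prod cyc) _ _.
  exact/commute_sym/commuteX.
by rewrite conjXg xy -expgnA; apply: commuteX2.
Qed.

(** The defect is a power of y, so y fixes it; but as a power of x it is raised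
    to the power r+1 by y. *)
Lemma defect_expr x y z r s t : conj_cycle x y z r s t ->
  defect x r s ^+ r = 1.
Proof.
move=> cyc; have [xy _ _] := cyc.
rewrite -(commg_expg1 _ xy) -/(defect x r s) (defect_expy cyc).
by apply/eqP/commgP/commute_sym; apply: commuteX.
Qed.

(** [w, z] is w^s because w is a power of y, and a power of z because w is a
    power of x; so w^s commutes with z. *)
Lemma defect_exps2 x y z r s t : conj_cycle x y z r s t ->
  defect x r s ^+ (s * s) = 1.
Proof.
move=> cyc; have [xy yz zx] := cyc.
have wz k : [~ defect x r s ^+ k, z] = defect x r s ^+ k ^+ s.
  by rewrite (defect_expy cyc) -expgnA (commg_expg1 _ yz).
rewrite expgnA -wz; apply/eqP/commgP.
have := wz 1%N; rewrite expg1 => <-; rewrite -invgR.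
apply/commute_sym/commuteV.
have := commg_expg 1 (twist r s * r) zx; rewrite expg1 mul1n => ->.
exact: commuteX.
Qed.

(** C = z^(twist t r) acts on <y> as the exponent S, which is 1 modulo s, and
    C^(g^2) acts trivially.  As w = y^(S-1), dividing S^(g^2) - 1 by S - 1 gives
    an exponent that kills w and is congruent to g^2 modulo s. *)
Lemma defect_exp4 x y z r s t g j : conj_cycle x y z r s t ->
  z ^+ (t * j) = z ^+ g -> defect x r s ^+ (g ^ 4) = 1.
Proof.
move=> cyc zg; have [xy yz zx] := cyc.
have zgn n : z ^+ (g * n) = z ^+ (t * (j * n)).
  by rewrite mulnA !(expgnA z _ n) zg.
(* C^(t^2) = 1, and C^g is a power of C^t because z^g is a power of z^t. *)
have zk : z ^+ (twist t r * (g * g)) = 1.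
  have -> : (twist t r * (g * g) = g * (g * twist t r))%N by lia.
  rewrite zgn; have -> : (t * (j * (g * twist t r)) = g * (t * j * twist t r))%N by lia.
  rewrite zgn; have -> : (t * (j * (t * j * twist t r)) =
    (twist t r * t * t) * (j * j))%N by lia.
  rewrite expgnA (expgnA z _ t).
  by rewrite (defect_expr (conj_cycle_rot (conj_cycle_rot cyc))) expg1n.
set S := (s.+1 ^ twist t r)%N.
have yS : y ^+ (S ^ (g * g)).-1 = 1.
  have := commg_expg 1 (twist t r * (g * g)) yz.
  by rewrite zk commg1 mul1n expnM => <-.
(* S = 1 modulo s, so the geometric sum is g^2 modulo s. *)
have [m sumS] : exists m, (\sum_(i < g * g) S ^ i = g * g + m * s)%N.
  elim: (g * g)%N => [|n [m IHn]]; first by exists 0; rewrite big_ord0.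
  exists (m + (\sum_(i < twist t r * n) s.+1 ^ i))%N.
  rewrite big_ord_recr /= IHn /S -expnM.
  rewrite -[(s.+1 ^ (twist t r * n))%N]prednK ?expn_gt0 // predn_exp /=.
  by lia.
set w := defect x r s.
have wsum : w ^+ (g * g + m * s) = 1.
  by rewrite -sumS /w (defect_expy cyc) -/S -expgnA -predn_exp.
have ws2 : w ^+ (s * s) = 1 := defect_exps2 cyc.
have wgs : w ^+ (g * g * s) = 1.
  have -> : 1 = w ^+ ((g * g + m * s) * s) by rewrite expgnA wsum expg1n.
  rewrite mulnDl expgnDr -mulnA -[(m * s * s)%N]mulnA [(m * _)%N]mulnC.
  by rewrite [w ^+ (s * s * m)]expgnA ws2 expg1n mulg1.
(* g^4 = (g^2 + m s) g^2 - m (g^2 s), and both terms kill w. *)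
have -> : 1 = w ^+ ((g * g + m * s) * (g * g)) by rewrite expgnA wsum expg1n.
rewrite mulnDl expgnDr.
have -> : (m * s * (g * g) = g * g * s * m)%N by lia.
by rewrite (expgnA w _ m) wgs expg1n mulg1 (_ : g ^ 4 = g * g * (g * g))%N //; lia.
Qed.

Lemma defect_eq1 x y z r s t al be ga i j k : conj_cycle x y z r s t ->
  x ^+ (r * i) = x ^+ al -> y ^+ (s * j) = y ^+ be -> z ^+ (t * k) = z ^+ ga ->
  gcdn al (gcdn be ga) = 1%N -> defect x r s = 1.
Proof.
move=> cyc xa yb zg co; set w := defect x r s.
have wa : w ^+ al = 1.
  rewrite /w /defect expgnAC -xa -expgnA.
  have -> : (r * i * (twist r s * r) = twist r s * r * r * i)%N by lia.
  by rewrite (expgnA x _ i) (expgnA x _ r) (defect_expr cyc) expg1n.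
(* The square would do; the fourth power matches the exponent ga^4, so that
   the gcd of the two is a power of gcd(be, ga). *)
have wb : w ^+ (be ^ 4) = 1.
  have -> : (be ^ 4 = be * (be * (be * be)))%N by lia.
  rewrite /w (defect_expy cyc) -expgnA; set l := _.-1.
  have ybn n : y ^+ (be * n) = y ^+ (s * (j * n)).
    by rewrite mulnA !(expgnA y _ n) yb.
  have -> : (l * (be * (be * (be * be))) = be * (be * (l * be * be)))%N by lia.
  rewrite ybn.
  have -> : (s * (j * (be * (l * be * be))) = be * (s * j * (l * be * be)))%N by lia.
  rewrite ybn.
  have -> : (s * (j * (s * j * (l * be * be))) = l * (s * s) * (j * j * be * be))%N by lia.
  by rewrite expgnA (expgnA y) -(defect_expy cyc) (defect_exps2 cyc) expg1n.
have wg : w ^+ (ga ^ 4) = 1 := defect_exp4 cyc zg.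
have {}wb := expg_gcdn_eq1 wb wg.
have := expg_gcdn_eq1 wa wb; rewrite (_ : gcdn _ _ = 1%N) ?expg1 //.
by rewrite gcdn_expn; apply/eqP/coprimeXr/eqP.
Qed.

(** Up to conjugation by y, the defect is [x^r, y^s]. *)
Lemma commute_of_defect_eq1 x y z r s t : conj_cycle x y z r s t ->
  defect x r s = 1 -> commute (x ^+ r) (y ^+ s).
Proof.
move=> cyc w1; have [xy _ _] := cyc.
apply/commgP; rewrite (commg_expg _ _ xy) -(conjg_eq1 _ y) conjXg xy -expgnA.
apply/eqP; rewrite -w1 /defect twistE; congr (_ ^+ _); lia.
Qed.

End ConjugationCycle.

(** * Subgroups generated by a subset, and the commutator subgroup *)

Inductive generated (H : groupType) (S : H -> Prop) : H -> Prop :=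
| GenIn u : S u -> generated S u
| GenOne : generated S 1
| GenMul u v : generated S u -> generated S v -> generated S (u * v)
| GenInv u : generated S u -> generated S u^-1.

Section Generated.
Variable H : groupType.
Implicit Types (S T : H -> Prop) (u v g h : H).

Lemma generated_commute S u v :
  (forall g h, S g -> S h -> commute g h) ->
  generated S u -> generated S v -> commute u v.
Proof.
move=> SC Su Sv; elim: Su => {u} [g Sg||g h _ Cg _ Ch|g _ Cg].
- elim: Sv => {v} [h Sh||h k _ Ch _ Ck|h _ Ch].
  + exact: SC.
  + exact: commute1.
  + exact: commuteM.
  + exact: commuteV.
- exact/commute_sym/commute1.
- by apply/commute_sym/commuteM; apply/commute_sym.
- exact/commute_sym/commuteV/commute_sym.
Qed.

Lemma generatedX S u n : generated S u -> generated S (u ^+ n).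
Proof.
move=> Su; elim: n => [|n IHn]; first exact: GenOne.
by rewrite expgS; apply: GenMul.
Qed.

Lemma generatedJ S T u h :
  (forall g, S g -> generated T (g ^ h)) ->
  generated S u -> generated T (u ^ h).
Proof.
move=> ST; elim=> {u} [g /ST //||g k _ Tg _ Tk|g _ Tg].
- by rewrite conj1g; apply: GenOne.
- by rewrite conjMg; apply: GenMul.
- by rewrite conjVg; apply: GenInv.
Qed.

(** Since the elements of S have finite order, their inverses are powers of
    them, so it is enough to conjugate by the elements of S themselves. *)
Lemma generated_normal S T h :
  (forall g, S g -> finite_order g) -> (forall g, generated S g) ->
  (forall g k, S g -> T k -> generated T (k ^ g)) ->
  forall u, generated T u -> generated T (u ^ h).
Proof.
move=> Sfin Sgen ST.
have STX g n u : S g -> generated T u -> generated T (u ^ (g ^+ n)).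
  move=> Sg; elim: n u => [|n IHn] u Tu; first by rewrite conjg1.
  rewrite expgS conjgM; apply: IHn.
  by apply: generatedJ Tu => k; apply: ST.
suff: forall u, generated T u -> generated T (u ^ h) /\ generated T (u ^ h^-1).
  by move=> P u /P[].
elim: (Sgen h) => {h} [g Sg u Tu||g h _ Pg _ Ph u Tu|g _ Pg u Tu].
- split; first by rewrite -[g]expg1; apply: STX.
  have [[|n] [n0 gn]] := Sfin g Sg; first by [].
  by rewrite (mulg1_eq (_ : g * g ^+ n = 1)) -?expgS //; apply: STX.
- by move=> u; rewrite invg1 conjg1.
- rewrite invgM !conjgM.
  by split; [apply Ph, Pg | apply Pg, Ph].
- by rewrite invgK; case: (Pg u Tu).
Qed.

(** Modulo a normal subgroup that contains the commutators of the generators,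
    each generator is central, hence so is everything. *)
Lemma derived_generated S T :
  (forall g, generated S g) ->
  (forall h u, generated T u -> generated T (u ^ h)) ->
  (forall g h, S g -> S h -> generated T [~ g, h]) ->
  forall u, derived u -> generated T u.
Proof.
move=> Sgen TJ ST u.
have TS g v : S g -> generated T [~ v, g].
  move=> Sg; elim: (Sgen v) => {v} [h Sh||h k _ Th _ Tk|h _ Th].
  - exact: ST.
  - by rewrite comm1g; apply: GenOne.
  - have -> : [~ h * k, g] = [~ h, g] ^ k * [~ k, g].
      by rewrite /commg !conjgE !invgM ?invgK ?mulgA !(mulgK, mulgVK).
    by apply: GenMul => //; apply: TJ.
  - have -> : [~ h^-1, g] = ([~ h, g]^-1) ^ h^-1.
      by rewrite /commg !conjgE !invgM ?invgK ?mulgA !(mulgK, mulgVK).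
    by apply/TJ/GenInv.
elim=> {u} [u v||u v _ Tu _ Tv|u _ Tu].
- elim: (Sgen v) u => {v} [g Sg u|u|h k _ Th _ Tk u|h _ Th u].
  + exact: TS.
  + by rewrite commg1; apply: GenOne.
  + have -> : [~ u, h * k] = [~ u, k] * [~ u, h] ^ k.
      by rewrite /commg !conjgE !invgM ?invgK ?mulgA !(mulgK, mulgVK).
    by apply: GenMul => //; apply: TJ.
  + have -> : [~ u, h^-1] = ([~ u, h]^-1) ^ h^-1.
      by rewrite /commg !conjgE !invgM !invgK !mulgA ?(mulgV, mul1g, mulgK, mulgVK).
    by apply/TJ/GenInv.
- exact: GenOne.
- exact: GenMul.
- exact: GenInv.
Qed.

End Generated.

(** * The commutator subgroup of a conjugation cycle *)

Definition among3 (T : Type) (x y z : T) : T -> Prop :=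
  fun g => [\/ g = x, g = y | g = z].

(** The subgroup is normal: x centralises x^r, y raises it to a power, and
    [z, x^r] = z^((t+1)^r - 1) is a power of z^t. *)
Lemma conj_cycle_derived (H : groupType) (x y z : H) (r s t : nat) :
  conj_cycle x y z r s t ->
  finite_order x -> finite_order y -> finite_order z ->
  (forall g, generated (among3 x y z) g) ->
  forall u, derived u -> generated (among3 (x ^+ r) (y ^+ s) (z ^+ t)) u.
Proof.
move=> cyc fx fy fz gen.
set T := among3 _ _ _.
have Tx : generated T (x ^+ r) by apply: GenIn; apply: Or31.
have Ty : generated T (y ^+ s) by apply: GenIn; apply: Or32.
have Tz : generated T (z ^+ t) by apply: GenIn; apply: Or33.
have step x' y' z' r' s' t' : conj_cycle x' y' z' r' s' t' ->
    generated T (x' ^+ r') -> generated T (z' ^+ t') ->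
  [/\ generated T (x' ^+ r' ^ x'), generated T (x' ^+ r' ^ y')
    & generated T (x' ^+ r' ^ z')]
  /\ [/\ generated T [~ x', x'], generated T [~ x', y']
    & generated T [~ y', x']].
  case=> xy _ zx Tx' Tz'.
  have comE : [~ x', y'] = x' ^+ r'.
    by have := commg_expg1 1 xy; rewrite expg1.
  split; split.
  - by rewrite conjXg conjgE mulKg.
  - by rewrite conjXg xy -expgnA mulnC expgnA; apply: generatedX.
  - rewrite -[_ ^ _](mulVKg (x' ^+ r')) -commgEl -invgR.
    apply: GenMul => //; apply: GenInv.
    have := commg_expg 1 r' zx; rewrite expg1 mul1n => ->.
    by rewrite predn_exp expgnA; apply: generatedX.
  - by rewrite commgg; apply: GenOne.
  - by rewrite comE.
  - by rewrite -invgR comE; apply: GenInv.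
have cyc' := conj_cycle_rot cyc; have cyc'' := conj_cycle_rot cyc'.
have [[xx xy xz] [rxx rxy ryx]] := step _ _ _ _ _ _ cyc Tx Tz.
have [[yy yz yx] [ryy ryz rzy]] := step _ _ _ _ _ _ cyc' Ty Tx.
have [[zz zx zy] [rzz rzx rxz]] := step _ _ _ _ _ _ cyc'' Tz Ty.
apply: (derived_generated gen) => [h u|g h [] -> [] -> //].
apply: (generated_normal _ _ gen) => [g [] -> //|g k [] -> [] -> //].
Qed.

Lemma derived_abelian_of_conj_cycle (H : groupType) (x y z : H)
    (r s t al be ga i j k : nat) :
  conj_cycle x y z r s t ->
  x ^+ (r * i) = x ^+ al -> y ^+ (s * j) = y ^+ be -> z ^+ (t * k) = z ^+ ga ->
  gcdn al (gcdn be ga) = 1%N ->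
  finite_order x -> finite_order y -> finite_order z ->
  (forall g, generated (among3 x y z) g) ->
  derived_abelian H.
Proof.
move=> cyc xal ybe zga co fx fy fz gen u v Du Dv.
have cyc' := conj_cycle_rot cyc; have cyc'' := conj_cycle_rot cyc'.
have dx := commute_of_defect_eq1 cyc (defect_eq1 cyc xal ybe zga co).
have dy : commute (y ^+ s) (z ^+ t).
  apply: (commute_of_defect_eq1 cyc' (defect_eq1 cyc' ybe zga xal _)).
  by rewrite gcdnA gcdnC.
have dz : commute (z ^+ t) (x ^+ r).
  apply: (commute_of_defect_eq1 cyc'' (defect_eq1 cyc'' zga xal ybe _)).
  by rewrite gcdnC -gcdnA.
have D w := conj_cycle_derived cyc fx fy fz gen (u := w).
apply: generated_commute (D u Du) (D v Dv) => g h [] -> [] -> //;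
  exact: commute_sym.
Qed.

(** * Reduction of integer exponents modulo the order *)

Lemma finite_order_exact (H : groupType) (h : H) : finite_order h ->
  exists n, [/\ (0 < n)%N, h ^+ n = 1 & forall m, h ^+ m = 1 -> (n %| m)%N].
Proof.
case=> n0 [n0_gt0 hn0].
have exn : exists n, (0 < n)%N && (h ^+ n == 1).
  by exists n0; rewrite n0_gt0 hn0 eqxx.
case: (ex_minnP exn) => n /andP[n_gt0 /eqP hn] nmin; exists n; split=> // m hm.
have := nmin (gcdn n m); rewrite gcdn_gt0 n_gt0 (expg_gcdn_eq1 hn hm) eqxx.
by move=> /(_ isT) le; apply/gcdn_idPl/eqP; rewrite eqn_leq le dvdn_leq ?dvdn_gcdl.
Qed.

Definition expgz (H : groupType) (h : H) (k : int) : H :=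
  match k with Posz n => h ^+ n | Negz n => h^-1 ^+ n.+1 end.

Lemma expgz_mod (H : groupType) (h : H) (n m : nat) (k q : int) :
  h ^+ n = 1 -> k = (m%:Z + q * n%:Z)%R -> expgz h k = h ^+ m.
Proof.
move=> hn kE.
have hX (p : nat) : h ^+ (p * n) = 1 by rewrite mulnC expgnA hn expg1n.
case: k q kE => k [] q kE /=.
- by rewrite (_ : k = m + q * n)%N ?expgnDr ?hX ?mulg1 //; lia.
- by rewrite -[LHS]mulg1 -(hX q.+1) -expgnDr; congr (_ ^+ _); lia.
- exfalso; lia.
- rewrite expVgn; apply: mulg1_eq; rewrite -expgnDr -(hX q.+1).
  by congr (_ ^+ _); lia.
Qed.

(** If n is the order of x, then a and b are units modulo n, and x^y = x^(b/a);
    with i inverse to a modulo n, b/a = 1 + (b-a) i modulo n. *)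
Lemma conj_of_conj_expgz (H : groupType) (x y : H) (a b : int) :
  finite_order x -> gcdz a b = 1%R -> (a < b)%R ->
  expgz x a ^ y = expgz x b ->
  exists r j, x ^ y = x ^+ r.+1 /\ x ^+ (r * j) = x ^+ `|b - a|%N.
Proof.
move=> /finite_order_exact[n [n0 xn xmin]] co lt_ab.
(* The Bezout relation below wants A > 0, so the representatives lie in
   [n, 2n). *)
have rep (k : int) : exists (m : nat) (q : int), (0 < m)%N /\ k = (m%:Z + q * n%:Z)%R.
  exists (`|(k %% n)%Z| + n)%N, ((k %/ n)%Z - 1)%R; split; first by lia.
  have k0 : (0 <= (k %% n)%Z)%R by apply: modz_ge0; lia.
  by rewrite PoszD gez0_abs // {1}(divz_eq k n); lia.
have [A [qa [A0 aE]]] := rep a; have [B [qb [_ bE]]] := rep b.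
rewrite (expgz_mod xn aE) (expgz_mod xn bE) => xAB.
(* With n = n' g, x^(A n') = 1, so its conjugate x^(B n') is 1 too: g divides
   B as well as A. *)
have coA : gcdn A n = 1%N.
  set g := gcdn A n.
  have [/dvdnP[A' AE] /dvdnP[n' nE]] := (dvdn_gcdl A n, dvdn_gcdr A n).
  have gB : (g %| B)%N.
    have n'0 : (0 < n')%N by move: n0; rewrite nE muln_gt0 => /andP[].
    rewrite -(dvdn_pmul2l n'0) -nE; apply: xmin.
    rewrite mulnC expgnA -xAB -conjXg -expgnA AE -mulnA (mulnC _ n') -nE.
    by rewrite mulnC expgnA xn expg1n conj1g.
  have : (g%:Z %| gcdz a b)%Z.
    have gn : (g%:Z %| n%:Z)%Z by exact: dvdn_gcdr.
    by rewrite dvdz_gcd aE bE !rpredD ?dvdz_mull //; apply: dvdn_gcdl.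
  by rewrite co dvdz1 => /eqP.
have [i k def_i _] := egcdnP n A0; rewrite coA in def_i.
have xi : x ^+ (A * i) = x.
  by rewrite mulnC def_i expgnDr mulnC expgnA xn expg1n mul1g.
exists (`|b - a| * i)%N, A; split.
  rewrite -{1}xi expgnA conjXg xAB -expgnA.
  apply: etrans (expgz_mod (k := (B * i)%:Z) (q := (qa - qb) * i + k) xn _).
    by [].
  nia.
by rewrite -mulnA (mulnC i) mulnC expgnA xi.
Qed.

(** * Morphisms from presented groups *)

Section Words.
Variables (S : choiceType) (R : seq (word S)) (Q : groupType).
Variable f : {multiplicative presented R -> Q}.

Lemma pres_morph_cat (u v : word S) :
  f (pres_class R (u ++ v)) = f (pres_class R u) * f (pres_class R v).
Proof. by rewrite -gmulfM; congr (f _); rewrite -pres_mulE. Qed.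

Lemma pres_morph_nil : f (pres_class R [::]) = 1.
Proof. by apply: (mulgI (f (pres_class R [::]))); rewrite mulg1 -pres_morph_cat. Qed.

Lemma pres_morph_winv (u : word S) :
  f (pres_class R (winv u)) = (f (pres_class R u))^-1.
Proof.
apply: invg_inj; rewrite invgK; apply: mulg1_eq.
by rewrite -pres_morph_cat -pres_morph_nil; congr (f _); apply/pres_classP/pres_eq_mulVw.
Qed.

Lemma pres_morph_wconj (u v : word S) :
  f (pres_class R (wconj u v)) = f (pres_class R u) ^ f (pres_class R v).
Proof. by rewrite /wconj !pres_morph_cat pres_morph_winv conjgE mulgA. Qed.

Lemma pres_morph_wpow (u : word S) (k : int) :
  f (pres_class R (wpow u k)) = expgz (f (pres_class R u)) k.
Proof.
have flat v n : f (pres_class R (flatten (nseq n v))) = f (pres_class R v) ^+ n.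
  by elim: n => [|n IHn]; [exact: pres_morph_nil | rewrite expgS /= pres_morph_cat IHn].
by case: k => n; rewrite flat ?pres_morph_winv.
Qed.

Lemma pres_morph_wrel (u v : word S) : wrel u v \in R ->
  f (pres_class R u) = f (pres_class R v).
Proof.
move=> Ruv; apply: divg1_eq; rewrite -pres_morph_winv -pres_morph_cat -pres_morph_nil.
congr (f _); apply/pres_classP.
by have := @PresRelator S R [::] _ [::] Ruv; rewrite cats0.
Qed.

Lemma generated_pres_morph (T : Q -> Prop) :
  (forall s, T (f (pres_gen R s))) -> forall w, generated T (f (pres_class R w)).
Proof.
move=> Tgen; elim=> [|[s b] w IHw]; first by rewrite pres_morph_nil; apply: GenOne.
rewrite -cat1s pres_morph_cat; apply: GenMul => //.
case: b; last exact/GenIn/Tgen.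
by rewrite (pres_morph_winv (wgen s)); apply/GenInv/GenIn/Tgen.
Qed.

End Words.

(** * The commutator subgroup of Q *)

Local Open Scope ring_scope.

Theorem corollary14 (a b c d e f : int)
    (a0 : a <> 0) (b0 : b <> 0) (c0 : c <> 0)
    (d0 : d <> 0) (e0 : e <> 0) (f0 : f <> 0)
    (coprime_ab : gcdz a b = 1) (coprime_cd : gcdz c d = 1)
    (coprime_ef : gcdz e f = 1)
    (ab_not_pm1 : ~ ((a = 1 \/ a = -1) /\ (b = 1 \/ b = -1)))
    (cd_not_pm1 : ~ ((c = 1 \/ c = -1) /\ (d = 1 \/ d = -1)))
    (ef_not_pm1 : ~ ((e = 1 \/ e = -1) /\ (f = 1 \/ f = -1)))
    (lt_ab : a < b) (lt_cd : c < d) (lt_ef : e < f)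
    (Q : groupType) (pi : {multiplicative Ggroup a b c d e f -> Q})
    (Q_univ : is_Q pi)
    (no_common_divisor : forall k : int,
      (k %| b - a)%Z -> (k %| d - c)%Z -> (k %| f - e)%Z -> k <= 1) :
  derived_abelian Q.
Proof.
have [[pi_surj fin] _] := Q_univ.
pose g i := pi (Ggen a b c d e f i).
have rel u v : wrel u v \in Grelators a b c d e f ->
    pi (pres_class _ u) = pi (pres_class _ v).
  exact: pres_morph_wrel.
have relx := rel (wconj (wpow (wgen gx) a) (wgen gy)) (wpow (wgen gx) b).
have rely := rel (wconj (wpow (wgen gy) c) (wgen gz)) (wpow (wgen gy) d).
have relz := rel (wconj (wpow (wgen gz) e) (wgen gx)) (wpow (wgen gz) f).
rewrite !pres_morph_wconj !pres_morph_wpow in relx rely relz.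
have {relx} := relx _; rewrite !inE eqxx => /(_ isT) relx.
have {rely} := rely _; rewrite !inE eqxx orbT => /(_ isT) rely.
have {relz} := relz _; rewrite !inE eqxx !orbT => /(_ isT) relz.
have [r [i [xy xr]]] := conj_of_conj_expgz (fin gx) coprime_ab lt_ab relx.
have [s [j [yz ys]]] := conj_of_conj_expgz (fin gy) coprime_cd lt_cd rely.
have [t [k [zx zt]]] := conj_of_conj_expgz (fin gz) coprime_ef lt_ef relz.
have cyc : conj_cycle (g gx) (g gy) (g gz) r s t by [].
apply: (derived_abelian_of_conj_cycle cyc xr ys zt).
- apply/eqP; rewrite eqn_leq; apply/andP; split.
    set n := gcdn _ _; suff: n%:Z <= 1 by [].
    by apply: no_common_divisor; rewrite /dvdz /=; apply/dvdnP/dvdnP;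
      rewrite /n ?dvdn_gcdl // (dvdn_trans (dvdn_gcdr _ _)) ?dvdn_gcdl ?dvdn_gcdr.
  by rewrite gcdn_gt0 absz_gt0 subr_eq0 gt_eqF.
- exact: fin.
- exact: fin.
- exact: fin.
move=> q; have [p <-] := pi_surj q; rewrite -(pres_repr p).
apply: generated_pres_morph => i0.
case: i0 => [[|[|[|//]]] Hi].
- by apply: Or31; rewrite /g; congr (pi (pres_gen _ _)); apply: val_inj.
- by apply: Or32; rewrite /g; congr (pi (pres_gen _ _)); apply: val_inj.
- by apply: Or33; rewrite /g; congr (pi (pres_gen _ _)); apply: val_inj.
Qed.
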